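(* Let $\tau:[0,\infty)\to[0,\infty)$ be continuous with $\lim_{t\to\infty}\{t-\tau(t)\}=\infty$, let $-\bar{\tau}=\inf_{t\ge 0}\{t-\tau(t)\}$, and suppose $\lim_{t\to\infty}\tau(t)/t=0$. Let $a>b>0$ and let $g:[0,\infty)\to[0,\infty)$ be continuous with $g(0)=0$, $g(x)>0$ for $x>0$, such that there is $\delta_1>0$ for which $g$ is increasing on $(0,\delta_1)$, and there is $\beta>1$ with $g\in\mathrm{RV}_0(\beta)$. Let $\psi\in C([-\bar\tau,0];(0,\infty))$. If the solution $x$ of $$x'(t)=-ag(x(t))+b\max_{t-\tau(t)\le s\le t}g(x(s)),\quad t\ge 0;\qquad x(t)=\psi(t),\quad t\in[-\bar\tau,0],$$ obeys $x(t)\to0$ as $t\to\infty$, and $G(x)=\int_x^1\frac{1}{g(u)}\,du$ for $x>0$, then $$\lim_{t\to\infty}\frac{G(x(t))}{t}=a-b.$$ Moreover $$\lim_{t\to\infty}\frac{x(t)}{G^{-1}(t)}=(a-b)^{-1/(\beta-1)}.$$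
   Context: A function $f$, positive near $0$ on the right, is regularly varying at zero with exponent $\alpha\in\mathbb{R}$, written $f\in\mathrm{RV}_0(\alpha)$, if $\lim_{t\to0^+}f(\lambda t)/f(t)=\lambda^\alpha$ for all $\lambda>0$. A solution of the equation is a continuous function $x:[-\bar\tau,\infty)\to(0,\infty)$, differentiable on $[0,\infty)$ (one-sided at $0$), satisfying the equation for all $t\ge0$ and equal to $\psi$ on $[-\bar\tau,0]$; solutions are positive. $G$ is strictly decreasing on $(0,\infty)$ with $G(x)\to\infty$ as $x\to0^+$, and $G^{-1}$ is its inverse. *)

(* Defs.v *)
(* Stdlib reals with Coquelicot. *)
From Stdlib Require Import Reals.
From Coquelicot Require Import Coquelicot.
Open Scope R_scope.

(* The clause [0 < lambda] makes [Rpower lambda alpha] the genuine real power. *)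
Definition RV0 (alpha : R) (f : R -> R) : Prop :=
  at_right 0 (fun t => 0 < f t) /\
  forall lambda : R, 0 < lambda ->
    filterlim (fun t => f (lambda * t) / f t) (at_right 0)
              (locally (Rpower lambda alpha)).

(* Derivative relative to [D]: two-sided at interior points of [D], one-sided
   at an endpoint, so that the values of [f] outside [D] do not matter. *)
Definition is_derive_within (D : R -> Prop) (f : R -> R) (t l : R) : Prop :=
  filterlim (fun s => (f s - f t) / (s - t)) (within D (locally' t)) (locally l).

Definition is_max_on (h : R -> R) (u v m : R) : Prop :=
  (forall s, u <= s <= v -> h s <= m) /\ (exists s, u <= s <= v /\ h s = m).

(* Functions on an interval are represented by total functions [R -> R] that are
   constrained on that interval only; [x] lives on [-taubar, oo), [psi] on
   [-taubar, 0], [tau] and [g] on [0, oo). *)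
Definition is_solution (a b taubar : R) (tau g psi x : R -> R) : Prop :=
  continuous_on (fun t => - taubar <= t) x /\
  (forall t, - taubar <= t -> 0 < x t) /\
  (forall t, - taubar <= t <= 0 -> x t = psi t) /\
  (forall t, 0 <= t ->
     exists m, is_max_on (fun s => g (x s)) (t - tau t) t m /\
       is_derive_within (fun s => 0 <= s) x t (- a * g (x t) + b * m)).

Definition G (g : R -> R) (x : R) : R := RInt (fun u => / g u) x 1.

(* [G g] is injective on (0, oo) when [g] is continuous and positive there, so
   this determines [Ginv] on the range of [G g]. *)
Definition is_G_inverse (g Ginv : R -> R) : Prop :=
  forall y, 0 < y -> Ginv (G g y) = y.

(* Main.v *)
Require Import Defs.
From Stdlib Require Import Reals Lra.
From Coquelicot Require Import Coquelicot.
Open Scope R_scope.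

(** In the variable [z t = G g (x t)] the equation reads
    [z'(t) = a - b * (max of g(x) over the delay window) / g(x t)].  The maximum is
    at least [g (x t)], so [z' <= a - b], which is the upper half of the first
    limit.  For the lower half it suffices that the maximum is asymptotically no
    larger than [g (x t)], for then [z'] tends to [a - b].

    This rests on two facts.  First, [G] is regularly varying at [0] with the
    negative exponent [1 - beta] ([RV0_G]), because it blows up at [0]
    ([G_unbounded_at_right0]) and the ratio of the derivatives of [G (k u)] and
    [G u] converges ([lhopital_at_right0]).  Consequently a small relative drop in
    [G] entails only a small relative rise in [g] ([g_ratio_of_G_ratio]).
    Secondly, over the delay window [z] does drop only by a small relative amount
    below its present value: its slope is at most [a - b], the window has
    length [o(t)], and [z] itself grows at least linearly, by a barrier argument
    ([delayed_slope_linear_growth]).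

    The second limit follows from the first by asymptotic inversion of the
    regularly varying decreasing function [G] ([G_asymptotic_inverse]). *)

(** * Neighbourhood forms of one-sided and infinite limits *)

Lemma at_right0_iff (P : R -> Prop) :
  at_right 0 P <-> exists d, 0 < d /\ forall t, 0 < t < d -> P t.
Proof.
  split.
  - intros [d Hd]. exists d. split; [apply cond_pos|].
    intros t Ht. apply Hd; [|lra].
    apply (norm_compat1 0 t d). simpl.
    change (Rabs (t - 0) < d). rewrite Rabs_pos_eq; lra.
  - intros [d [Hd H]]. exists (mkposreal d Hd). intros t Ht H0.
    apply H. split; [exact H0|].
    change (Rabs (t - 0) < d) in Ht. rewrite Rabs_pos_eq in Ht; lra.
Qed.

Lemma filterlim_at_right0 (f : R -> R) (l : R) :
  filterlim f (at_right 0) (locally l) <->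
  forall eps, 0 < eps ->
    exists d, 0 < d /\ forall t, 0 < t < d -> Rabs (f t - l) < eps.
Proof.
  rewrite filterlim_locally. split.
  - intros H eps He. apply at_right0_iff. exact (H (mkposreal eps He)).
  - intros H eps. apply at_right0_iff. exact (H eps (cond_pos eps)).
Qed.

Lemma is_lim_p_infty_iff (f : R -> R) (l : R) :
  is_lim f p_infty (Finite l) <->
  forall eps, 0 < eps -> exists M, forall t, M < t -> Rabs (f t - l) < eps.
Proof.
  rewrite <- is_lim_spec. split.
  - intros H eps He. exact (H (mkposreal eps He)).
  - intros H eps. exact (H eps (cond_pos eps)).
Qed.

Lemma is_lim_p_infty_p_infty_iff (f : R -> R) :
  is_lim f p_infty p_infty <->
  forall K, exists M, forall t, M < t -> K < f t.
Proof. rewrite <- is_lim_spec. split; intros H; exact H. Qed.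

(** * Growth, barriers and L'Hopital's rule *)

Lemma derive_ge_growth (f f' : R -> R) (k u v : R) :
  u <= v ->
  (forall t, u <= t <= v -> is_derive f t (f' t)) ->
  (forall t, u <= t <= v -> k <= f' t) ->
  k * (v - u) <= f v - f u.
Proof.
  intros [Huv| ->] Hd Hk; [|lra].
  destruct (MVT_cor2 f f' u v Huv) as [c [-> Hc]].
  - intros c Hc. apply is_derive_Reals, Hd, Hc.
  - apply Rmult_le_compat_r; [lra|]. apply Hk; lra.
Qed.

Lemma derive_le_growth (f f' : R -> R) (k u v : R) :
  u <= v ->
  (forall t, u <= t <= v -> is_derive f t (f' t)) ->
  (forall t, u <= t <= v -> f' t <= k) ->
  f v - f u <= k * (v - u).
Proof.
  intros [Huv| ->] Hd Hk; [|lra].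
  destruct (MVT_cor2 f f' u v Huv) as [c [-> Hc]].
  - intros c Hc. apply is_derive_Reals, Hd, Hc.
  - apply Rmult_le_compat_r; [lra|]. apply Hk; lra.
Qed.

Lemma is_derive_continuity_pt (f : R -> R) (t l : R) :
  is_derive f t l -> continuity_pt f t.
Proof.
  intros H. apply derivable_continuous_pt. exists l. apply is_derive_Reals, H.
Qed.

Lemma continuity_pt_gt_nbhd (f : R -> R) (t k : R) :
  continuity_pt f t -> k < f t ->
  exists d, 0 < d /\ forall s, Rabs (s - t) < d -> k < f s.
Proof.
  intros Hc Hk. destruct (Hc (f t - k)) as [d [Hd H]]; [lra|].
  exists d. split; [exact Hd|]. intros s Hs.
  destruct (Req_dec t s) as [<-|Hne]; [exact Hk|].
  assert (Hb : Rabs (f s - f t) < f t - k).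
  { apply (H s). split; [|exact Hs]. split; [exact I|exact Hne]. }
  apply Rabs_def2 in Hb. lra.
Qed.

(** Barrier principle: at a first zero the function comes down from positive
    values, so its derivative there cannot be positive.  The slope condition is
    asked only at zeros preceded by positive values, because that is where a
    bound on the past makes a delay equation informative. *)
Lemma positive_of_positive_slope_at_zeros (f f' : R -> R) (u : R) :
  (forall t, u <= t -> is_derive f t (f' t)) ->
  0 < f u ->
  (forall t, u < t -> f t = 0 -> (forall s, u <= s < t -> 0 < f s) ->
     0 < f' t) ->
  forall t, u <= t -> 0 < f t.
Proof.
  intros Hd Hu Hz t Ht.
  destruct (Rlt_le_dec 0 (f t)) as [|Hneg]; [assumption|exfalso].
  set (E := fun r => u <= r /\ forall s, u <= s <= r -> 0 < f s).
  destruct (completeness E) as [r [Hub Hlub]].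
  - exists t. intros r [_ Hr]. destruct (Rle_lt_dec r t) as [|Hlt]; [assumption|].
    specialize (Hr t). lra.
  - exists u. split; [lra|]. intros s Hs. replace s with u by lra. exact Hu.
  (* [r] is the supremum of the times up to which [f] stays positive. *)
  - assert (Hur : u <= r).
    { apply Hub. split; [lra|]. intros s Hs. replace s with u by lra. exact Hu. }
    assert (Hlt : forall s, u <= s < r -> 0 < f s).
    { intros s Hs. destruct (Rlt_le_dec 0 (f s)) as [|Hle]; [assumption|].
      assert (r <= s); [|lra]. apply Hlub. intros q [_ Hq].
      destruct (Rle_lt_dec q s) as [|Hqs]; [assumption|].
      specialize (Hq s). lra. }
    assert (Hcr : continuity_pt f r)
      by (apply (is_derive_continuity_pt f r (f' r)), Hd, Hur).
    destruct (Rlt_le_dec 0 (f r)) as [Hpos|Hle].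
    + destruct (continuity_pt_gt_nbhd f r 0 Hcr Hpos) as [d [Hd0 Hnb]].
      assert (r + d / 2 <= r); [|lra]. apply Hub. split; [lra|].
      intros s Hs. destruct (Rlt_le_dec s r) as [Hsr|Hsr]; [apply Hlt; lra|].
      apply Hnb. rewrite Rabs_pos_eq; lra.
    + assert (Hur' : u < r).
      { destruct Hur as [|Heq]; [assumption|]. rewrite <- Heq in Hle. lra. }
      assert (Hr0 : f r = 0).
      { destruct Hle as [Hltr|]; [exfalso|assumption].
        destruct (continuity_pt_gt_nbhd (fun s => - f s) r 0)
          as [d [Hd0 Hnb]]; [apply continuity_pt_opp, Hcr|lra|].
        set (s := Rmax u (r - d / 2)).
        assert (Hs : u <= s /\ r - d / 2 <= s /\ s < r).
        { unfold s. repeat split; [apply Rmax_l|apply Rmax_r|].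
          apply Rmax_lub_lt; lra. }
        specialize (Hlt s). specialize (Hnb s).
        rewrite Rabs_left in Hnb by lra. lra. }
      specialize (Hz r Hur' Hr0 Hlt).
      assert (Hder := proj1 (is_derive_Reals _ _ _) (Hd r Hur)).
      destruct (Hder (f' r) Hz) as [d Hdd].
      set (h := Rmin (r - u) (d / 2)).
      assert (Hdp := cond_pos d).
      assert (Hh : 0 < h /\ h <= r - u /\ h <= d / 2).
      { unfold h. repeat split; [|apply Rmin_l|apply Rmin_r].
        apply Rmin_glb_lt; lra. }
      specialize (Hdd (- h)).
      rewrite Hr0, Rabs_Ropp, (Rabs_pos_eq h) in Hdd by lra.
      specialize (Hdd ltac:(lra) ltac:(lra)).
      apply Rabs_def2 in Hdd.
      assert (Hfs : 0 < f (r + - h)) by (apply Hlt; lra).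
      assert (Hneg' : (f (r + - h) - 0) / - h < 0); [|lra].
      replace ((f (r + - h) - 0) / - h) with (- (f (r + - h) * / h))
        by (field; lra).
      assert (0 < f (r + - h) * / h); [|lra].
      apply Rmult_lt_0_compat; [assumption|]. apply Rinv_0_lt_compat; lra.
Qed.

(** L'Hopital's rule for a denominator that tends to infinity at [0+].  If
    [F' / H'] is within [eps / 2] of [l] near [0], then [F - (l + eps / 2) H] and
    [F - (l - eps / 2) H] are monotone there, hence bounded on the side that
    matters; dividing by [H], which grows without bound, removes the
    constants. *)
Lemma lhopital_at_right0 (F F' H H' : R -> R) (l d : R) :
  0 < d ->
  (forall u, 0 < u < d -> is_derive F u (F' u)) ->
  (forall u, 0 < u < d -> is_derive H u (H' u)) ->
  (forall u, 0 < u < d -> H' u < 0) ->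
  (forall K, exists e, 0 < e /\ forall u, 0 < u < e -> K < H u) ->
  filterlim (fun u => F' u / H' u) (at_right 0) (locally l) ->
  filterlim (fun u => F u / H u) (at_right 0) (locally l).
Proof.
  intros Hd HF HH Hneg Hinf Hlim.
  apply filterlim_at_right0. intros eps Heps.
  destruct (proj1 (filterlim_at_right0 _ _) Hlim (eps / 2))
    as [e [He Hr]]; [lra|].
  set (w := Rmin d e / 2).
  assert (Hw : 0 < w /\ w < d /\ w < e).
  { assert (H1 := Rmin_l d e). assert (H2 := Rmin_r d e).
    assert (0 < Rmin d e) by (apply Rmin_glb_lt; lra).
    unfold w. lra. }
  assert (Hq : forall u, 0 < u <= w ->
     (l + eps / 2) * H' u <= F' u <= (l - eps / 2) * H' u).
  { intros u Hu. specialize (Hr u ltac:(lra)). apply Rabs_def2 in Hr.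
    assert (HN : H' u < 0) by (apply Hneg; lra).
    replace (F' u) with (F' u / H' u * H' u) by (field; lra).
    split; rewrite 2!(Rmult_comm _ (H' u)); apply Rmult_le_compat_neg_l; lra. }
  assert (Hup : forall u, 0 < u <= w ->
     F u - (l + eps / 2) * H u <= F w - (l + eps / 2) * H w).
  { intros u Hu.
    assert (Hg := derive_ge_growth (fun v => F v - (l + eps / 2) * H v)
      (fun v => F' v - (l + eps / 2) * H' v) 0 u w (proj2 Hu)).
    cut (0 * (w - u) <= F w - (l + eps / 2) * H w - (F u - (l + eps / 2) * H u));
      [lra|].
    apply Hg; intros v Hv; [|specialize (Hq v); lra].
    apply (is_derive_minus (V := R_NormedModule)); [apply HF; lra|].
    apply is_derive_scal. apply HH; lra. }
  assert (Hlo : forall u, 0 < u <= w ->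
     F w - (l - eps / 2) * H w <= F u - (l - eps / 2) * H u).
  { intros u Hu.
    assert (Hg := derive_le_growth (fun v => F v - (l - eps / 2) * H v)
      (fun v => F' v - (l - eps / 2) * H' v) 0 u w (proj2 Hu)).
    cut (F w - (l - eps / 2) * H w - (F u - (l - eps / 2) * H u) <= 0 * (w - u));
      [lra|].
    apply Hg; intros v Hv; [|specialize (Hq v); lra].
    apply (is_derive_minus (V := R_NormedModule)); [apply HF; lra|].
    apply is_derive_scal. apply HH; lra. }
  set (K1 := F w - (l + eps / 2) * H w) in *.
  set (K2 := F w - (l - eps / 2) * H w) in *.
  destruct (Hinf (2 * (Rabs K1 + Rabs K2) / eps)) as [e' [He' HK]].
  exists (Rmin w e'). split; [apply Rmin_glb_lt; lra|].
  intros u [Hu0 Hu].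
  assert (H1 := Rmin_l w e'). assert (H2 := Rmin_r w e').
  specialize (HK u ltac:(lra)). specialize (Hup u ltac:(lra)).
  specialize (Hlo u ltac:(lra)).
  assert (HA : Rabs K1 + Rabs K2 < eps / 2 * H u).
  { apply Rmult_lt_compat_r with (r := eps / 2) in HK; [|lra].
    replace (2 * (Rabs K1 + Rabs K2) / eps * (eps / 2))
      with (Rabs K1 + Rabs K2) in HK by (field; lra). lra. }
  assert (HP1 := Rle_abs K1). assert (HP2 := Rle_abs (- K2)).
  rewrite Rabs_Ropp in HP2.
  assert (HP3 := Rabs_pos K1). assert (HP4 := Rabs_pos K2).
  assert (HHu : 0 < H u).
  { apply Rmult_lt_reg_l with (eps / 2); lra. }
  apply Rabs_def1.
  - apply Rmult_lt_reg_r with (H u); [exact HHu|].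
    replace ((F u / H u - l) * H u) with (F u - l * H u) by (field; lra). lra.
  - apply Rmult_lt_reg_r with (H u); [exact HHu|].
    replace ((F u / H u - l) * H u) with (F u - l * H u) by (field; lra). lra.
Qed.

(** * Regular variation of [G] *)

Lemma continuous_on_interior (D : R -> Prop) (f : R -> R) (u : R) :
  continuous_on D f -> D u -> locally u D -> continuous f u.
Proof.
  intros Hc Hu Hl P HP. specialize (Hc u Hu P HP).
  unfold filtermap, within in *. generalize (filter_and _ _ Hl Hc).
  apply filter_imp. intros v [Hv HPv]. apply HPv, Hv.
Qed.

Lemma locally_gt (k u : R) : k < u -> locally u (fun v => k < v).
Proof. intros H. apply (open_gt k u H). Qed.

Lemma ex_RInt_inv_pos (g : R -> R) (u v : R) :
  (forall w, 0 < w -> 0 < g w) -> (forall w, 0 < w -> continuous g w) ->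
  0 < u -> 0 < v -> ex_RInt (fun w => / g w) u v.
Proof.
  intros Hp Hc Hu Hv. apply (ex_RInt_continuous (V := R_CompleteNormedModule)).
  intros w Hw. assert (0 < Rmin u v) by (apply Rmin_glb_lt; assumption).
  apply continuous_Rinv_comp; [apply Hc; lra|].
  apply Rgt_not_eq, Hp; lra.
Qed.

Lemma is_derive_G (g : R -> R) (u : R) :
  (forall w, 0 < w -> 0 < g w) -> (forall w, 0 < w -> continuous g w) ->
  0 < u -> is_derive (G g) u (- / g u).
Proof.
  intros Hp Hc Hu.
  apply (is_derive_RInt' (V := R_NormedModule) (fun w => / g w) (G g) u 1).
  - generalize (locally_gt 0 u Hu). apply filter_imp. intros v Hv.
    apply (RInt_correct (V := R_CompleteNormedModule)).
    apply ex_RInt_inv_pos; auto; lra.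
  - apply continuous_Rinv_comp; [apply Hc, Hu|]. apply Rgt_not_eq, Hp, Hu.
Qed.

Lemma G_decreasing (g : R -> R) (u v : R) :
  (forall w, 0 < w -> 0 < g w) -> (forall w, 0 < w -> continuous g w) ->
  0 < u < v -> G g v < G g u.
Proof.
  intros Hp Hc [Hu Huv].
  destruct (MVT_cor2 (G g) (fun w => - / g w) u v Huv) as [c [Heq Hcv]].
  - intros w Hw. apply is_derive_Reals, is_derive_G; auto; lra.
  - assert (0 < / g c * (v - u)); [|lra].
    apply Rmult_lt_0_compat; [|lra]. apply Rinv_0_lt_compat, Hp; lra.
Qed.

Lemma is_derive_G_scal (g : R -> R) (k u : R) :
  (forall w, 0 < w -> 0 < g w) -> (forall w, 0 < w -> continuous g w) ->
  0 < k -> 0 < u ->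
  is_derive (fun v => G g (k * v)) u (- (k / g (k * u))).
Proof.
  intros Hp Hc Hk Hu.
  replace (- (k / g (k * u))) with (scal k (- / g (k * u))).
  - apply (is_derive_comp (V := R_NormedModule) (G g) (fun v => k * v)).
    + apply is_derive_G; auto. apply Rmult_lt_0_compat; assumption.
    + auto_derive; [exact I|ring].
  - change (k * - / g (k * u) = - (k / g (k * u))). unfold Rdiv. ring.
Qed.

Lemma RV0_eventually_lt (g : R -> R) (beta k q : R) :
  (forall w, 0 < w -> 0 < g w) ->
  RV0 beta g -> 0 < k -> Rpower k beta < q ->
  exists d, 0 < d /\ forall u, 0 < u < d -> g (k * u) < q * g u.
Proof.
  intros Hp [_ Hrv] Hk Hq.
  destruct (proj1 (filterlim_at_right0 _ _) (Hrv k Hk) (q - Rpower k beta))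
    as [d [Hd H]]; [lra|].
  exists d. split; [exact Hd|]. intros u Hu. specialize (H u Hu).
  apply Rabs_def2 in H. assert (Hgu : 0 < g u) by (apply Hp; lra).
  replace (g (k * u)) with (g (k * u) / g u * g u) by (field; lra).
  apply Rmult_lt_compat_r; lra.
Qed.

Lemma RV0_eventually_gt (g : R -> R) (beta k q : R) :
  (forall w, 0 < w -> 0 < g w) ->
  RV0 beta g -> 0 < k -> q < Rpower k beta ->
  exists d, 0 < d /\ forall u, 0 < u < d -> q * g u < g (k * u).
Proof.
  intros Hp [_ Hrv] Hk Hq.
  destruct (proj1 (filterlim_at_right0 _ _) (Hrv k Hk) (Rpower k beta - q))
    as [d [Hd H]]; [lra|].
  exists d. split; [exact Hd|]. intros u Hu. specialize (H u Hu).
  apply Rabs_def2 in H. assert (Hgu : 0 < g u) by (apply Hp; lra).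
  replace (g (k * u)) with (g (k * u) / g u * g u) by (field; lra).
  apply Rmult_lt_compat_r; lra.
Qed.

(** Since [2 ^ beta > 2], one has [g (2 v) > 2 g v] near [0], so
    [G g v - G g (2 v)] has a nonpositive derivative.  The integrals of [1 / g]
    over the dyadic blocks from [w / 2 ^ (n+1)] to [w / 2 ^ n] are therefore
    bounded below by the one from [w] to [2 w], and their sum diverges. *)
Lemma G_unbounded_at_right0 (g : R -> R) (beta : R) :
  (forall w, 0 < w -> 0 < g w) -> (forall w, 0 < w -> continuous g w) ->
  1 < beta -> RV0 beta g ->
  forall K, exists e, 0 < e /\ forall u, 0 < u < e -> K < G g u.
Proof.
  intros Hp Hc Hb Hrv.
  destruct (RV0_eventually_gt g beta 2 2 Hp Hrv) as [d [Hd Hg]]; [lra| |].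
  { rewrite <- (Rpower_1 2) at 1 by lra. apply Rpower_lt; lra. }
  set (w := d / 2).
  set (c := G g w - G g (2 * w)).
  assert (Hc0 : 0 < c).
  { assert (G g (2 * w) < G g w); [|unfold c; lra].
    apply G_decreasing; auto. unfold w; lra. }
  assert (Hblock : forall u, 0 < u <= w -> c + G g (2 * u) <= G g u).
  { intros u Hu.
    assert (Hgr := derive_le_growth (fun v => G g v - G g (2 * v))
      (fun v => - / g v - - (2 / g (2 * v))) 0 u w (proj2 Hu)).
    cut (G g w - G g (2 * w) - (G g u - G g (2 * u)) <= 0 * (w - u));
      [unfold c; lra|].
    apply Hgr; intros v Hv.
    - apply (is_derive_minus (V := R_NormedModule)).
      + apply is_derive_G; auto; lra.
      + apply is_derive_G_scal; auto; lra.
    - assert (Hgv : 0 < g v) by (apply Hp; lra).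
      assert (Hg2 : 2 * g v < g (2 * v)) by (apply Hg; unfold w in Hv; lra).
      assert (2 / g (2 * v) <= / g v); [|lra].
      apply Rmult_le_reg_r with (g v * g (2 * v)); [nra|].
      replace (2 / g (2 * v) * (g v * g (2 * v))) with (2 * g v)
        by (field; lra).
      replace (/ g v * (g v * g (2 * v))) with (g (2 * v)) by (field; lra).
      lra. }
  assert (Hpow : forall n, G g w + INR n * c <= G g (w / 2 ^ n)).
  { induction n as [|n IH].
    - simpl. replace (w / 1) with w by field. lra.
    - rewrite S_INR.
      assert (H2n : 0 < 2 ^ n) by (apply pow_lt; lra).
      assert (H1n : 1 <= 2 ^ n) by (apply pow_R1_Rle; lra).
      assert (Hw : 0 < w) by (unfold w; lra).
      assert (Hle : w / 2 ^ S n <= w).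
      { apply Rmult_le_reg_r with (2 ^ S n); [apply pow_lt; lra|].
        unfold Rdiv. rewrite Rmult_assoc, Rinv_l, Rmult_1_r
          by (apply pow_nonzero; lra).
        simpl. nra. }
      assert (Hpos : 0 < w / 2 ^ S n).
      { apply Rdiv_lt_0_compat; [assumption|apply pow_lt; lra]. }
      specialize (Hblock (w / 2 ^ S n) (conj Hpos Hle)).
      replace (2 * (w / 2 ^ S n)) with (w / 2 ^ n) in Hblock
        by (simpl; field; lra).
      lra. }
  intros K.
  destruct (INR_unbounded ((K - G g w) / c)) as [n Hn].
  assert (H2n : 0 < 2 ^ n) by (apply pow_lt; lra).
  exists (w / 2 ^ n). split.
  - apply Rdiv_lt_0_compat; [unfold w; lra|assumption].
  - intros u Hu. apply Rle_lt_trans with (G g (w / 2 ^ n)).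
    + apply Rle_trans with (2 := Hpow n).
      apply Rmult_lt_compat_r with (r := c) in Hn; [|assumption].
      replace ((K - G g w) / c * c) with (K - G g w) in Hn by (field; lra). lra.
    + apply G_decreasing; auto.
Qed.

(** Karamata's theorem for [G].  The ratio of the derivatives of
    [u |-> G g (k u)] and [G g] is [k g(u) / g(k u)], which tends to
    [k / k ^ beta], and L'Hopital's rule transfers this limit to the functions
    themselves. *)
Lemma RV0_G (g : R -> R) (beta : R) :
  (forall w, 0 < w -> 0 < g w) -> (forall w, 0 < w -> continuous g w) ->
  1 < beta -> RV0 beta g -> RV0 (1 - beta) (G g).
Proof.
  intros Hp Hc Hb Hrv.
  assert (Hinf := G_unbounded_at_right0 g beta Hp Hc Hb Hrv).
  split; [apply at_right0_iff, Hinf|].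
  intros k Hk.
  apply lhopital_at_right0 with (d := 1) (F' := fun u => - (k / g (k * u)))
    (H' := fun u => - / g u); [lra| | | |exact Hinf|].
  - intros u Hu. apply is_derive_G_scal; auto; lra.
  - intros u Hu. apply is_derive_G; auto; lra.
  - intros u Hu. assert (0 < / g u); [|lra].
    apply Rinv_0_lt_compat, Hp; lra.
  - assert (Hlim : filterlim (fun u => k * / (g (k * u) / g u)) (at_right 0)
      (locally (k * / Rpower k beta))).
    { assert (Hpk : Rpower k beta <> 0)
        by (apply Rgt_not_eq; unfold Rpower; apply exp_pos).
      apply filterlim_comp with (2 := continuous_mult (fun _ => k) Rinv _
        (continuous_const _ _) (continuous_Rinv _ Hpk)).
      apply (proj2 Hrv k Hk). }
    replace (Rpower k (1 - beta)) with (k * / Rpower k beta).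
    + apply filterlim_ext_loc with (2 := Hlim). apply at_right0_iff.
      exists 1. split; [lra|]. intros u Hu.
      assert (0 < g u) by (apply Hp; lra).
      assert (0 < g (k * u)) by (apply Hp, Rmult_lt_0_compat; lra).
      field. lra.
    + unfold Rminus. rewrite Rpower_plus, Rpower_Ropp, Rpower_1 by assumption.
      reflexivity.
Qed.

Lemma Rpower_lt_base_neg (u v c : R) :
  c < 0 -> 0 < u < v -> Rpower v c < Rpower u c.
Proof.
  intros Hc [Hu Huv]. unfold Rpower. apply exp_increasing.
  assert (ln u < ln v) by (apply ln_increasing; assumption). nra.
Qed.

(** Relative closeness in [G] gives relative closeness in [g].  Take [k > 1] with
    [k ^ beta < 1 + eta].  Regular variation of [G] with negative exponent makes
    [G g (k u)] smaller than [G g u] by a fixed factor, so [G g v] close to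
    [G g u] forces [v <= k u]; monotonicity and regular variation of [g] then
    bound [g v] by [g (k u) <= (1 + eta) g u]. *)
Lemma g_ratio_of_G_ratio (g : R -> R) (beta eta : R) :
  (forall w, 0 < w -> 0 < g w) -> (forall w, 0 < w -> continuous g w) ->
  (exists d, 0 < d /\ forall u v, 0 < u -> u <= v -> v < d -> g u <= g v) ->
  1 < beta -> RV0 beta g -> 0 < eta ->
  exists eps d, 0 < eps < 1 /\ 0 < d /\
    forall u v, 0 < u < d -> 0 < v -> (1 - eps) * G g u <= G g v ->
      g v <= (1 + eta) * g u.
Proof.
  intros Hp Hc [d0 [Hd0 Hinc]] Hb Hrv Heta.
  set (k := Rpower (1 + eta / 2) (/ beta)).
  assert (Hbi : 0 < / beta) by (apply Rinv_0_lt_compat; lra).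
  assert (Hk : 1 < k).
  { unfold k. rewrite <- (Rpower_O (1 + eta / 2)) at 1 by lra.
    apply Rpower_lt; lra. }
  assert (Hkb : Rpower k beta = 1 + eta / 2).
  { unfold k. rewrite Rpower_mult, Rinv_l, Rpower_1; lra. }
  assert (Hkg : Rpower k (1 - beta) < 1).
  { rewrite <- (Rpower_O k) at 2 by lra. apply Rpower_lt; lra. }
  assert (Hkp : 0 < Rpower k (1 - beta)) by (unfold Rpower; apply exp_pos).
  destruct (RV0_eventually_lt g beta k (1 + eta) Hp Hrv) as [d1 [Hd1 H1]];
    [lra|lra|].
  destruct (RV0_G g beta Hp Hc Hb Hrv) as [HGp HGl].
  (* [1 - eps] is the midpoint between [k ^ (1 - beta)] and [1], so that
     [G g (k u) / G g u < 1 - eps] near [0]. *)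
  set (eps := (1 - Rpower k (1 - beta)) / 2).
  destruct (proj1 (filterlim_at_right0 _ _) (HGl k ltac:(lra)) eps)
    as [d2 [Hd2 H2]]; [unfold eps; lra|].
  destruct (proj1 (at_right0_iff _) HGp) as [d3 [Hd3 H3]].
  set (d := Rmin (Rmin d1 d2) (Rmin d3 (d0 / k))).
  assert (Hdk : 0 < d0 / k) by (apply Rdiv_lt_0_compat; lra).
  assert (Hd : 0 < d /\ d <= d1 /\ d <= d2 /\ d <= d3 /\ d <= d0 / k).
  { assert (A1 := Rmin_l (Rmin d1 d2) (Rmin d3 (d0 / k))).
    assert (A2 := Rmin_r (Rmin d1 d2) (Rmin d3 (d0 / k))).
    assert (A3 := Rmin_l d1 d2). assert (A4 := Rmin_r d1 d2).
    assert (A5 := Rmin_l d3 (d0 / k)). assert (A6 := Rmin_r d3 (d0 / k)).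
    unfold d. split; [|lra].
    repeat apply Rmin_glb_lt; assumption. }
  exists eps, d. split; [unfold eps; lra|]. split; [lra|].
  intros u v Hu Hv HG.
  specialize (H1 u ltac:(lra)). specialize (H2 u ltac:(lra)).
  specialize (H3 u ltac:(lra)).
  assert (Hku : k * u < d0).
  { replace d0 with (k * (d0 / k)) by (field; lra).
    apply Rmult_lt_compat_l; lra. }
  assert (Hku0 : 0 < k * u) by nra.
  apply Rle_trans with (g (k * u)); [|lra].
  apply Hinc; [assumption| |assumption].
  destruct (Rle_lt_dec v (k * u)) as [|Hlt]; [assumption|exfalso].
  assert (HGv : G g v < G g (k * u)) by (apply G_decreasing; auto).
  apply Rabs_def2 in H2.
  assert (HGk : G g (k * u) < (1 - eps) * G g u); [|lra].
  replace (G g (k * u)) with (G g (k * u) / G g u * G g u) by (field; lra).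
  apply Rmult_lt_compat_r; [assumption|]. unfold eps in *. lra.
Qed.

Lemma G_onto_large (g : R -> R) (t : R) :
  (forall w, 0 < w -> 0 < g w) -> (forall w, 0 < w -> continuous g w) ->
  (forall K, exists e, 0 < e /\ forall u, 0 < u < e -> K < G g u) ->
  0 < t -> exists y, 0 < y /\ G g y = t.
Proof.
  intros Hp Hc Hinf Ht.
  destruct (Hinf t) as [e [He Hbig]].
  set (u := Rmin e 1 / 2).
  assert (Hu : 0 < u /\ u < e /\ u < 1).
  { assert (H1 := Rmin_l e 1). assert (H2 := Rmin_r e 1).
    assert (0 < Rmin e 1) by (apply Rmin_glb_lt; lra). unfold u. lra. }
  assert (HG1 : G g 1 = 0) by exact (RInt_point (V := R_CompleteNormedModule) 1 (fun w => / g w)).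
  destruct (Ranalysis5.IVT_interv (fun v => t - G g v) u 1) as [y [Hy Hyt]].
  - intros v Hv. apply continuity_pt_minus.
    + apply continuity_pt_const. intros p q. reflexivity.
    + apply is_derive_continuity_pt with (- / g v).
      apply is_derive_G; auto; lra.
  - lra.
  - specialize (Hbig u). lra.
  - lra.
  - exists y. split; lra.
Qed.

(** Inverting [G] asymptotically.  By regular variation [G g (k * Ginv t)] is
    equivalent to [k ^ (1 - beta) t], while [G g (x t)] is equivalent to [c t].
    The exponent being negative, [k ^ (1 - beta)] is below [c] for [k] above the
    claimed limit and above [c] for smaller [k]; as [G g] decreases, this places
    [x t] on the corresponding side of [k * Ginv t]. *)
Lemma G_asymptotic_inverse (g x Ginv : R -> R) (beta c : R) :
  (forall w, 0 < w -> 0 < g w) -> (forall w, 0 < w -> continuous g w) ->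
  1 < beta -> RV0 beta g -> is_G_inverse g Ginv -> 0 < c ->
  (forall t, 0 < t -> 0 < x t) ->
  is_lim (fun t => G g (x t) / t) p_infty (Finite c) ->
  is_lim (fun t => x t / Ginv t) p_infty
         (Finite (Rpower c (- (1 / (beta - 1))))).
Proof.
  intros Hp Hc Hb Hrv Hinv Hc0 Hx Hlim.
  assert (Hinf := G_unbounded_at_right0 g beta Hp Hc Hb Hrv).
  destruct (RV0_G g beta Hp Hc Hb Hrv) as [_ HGl].
  set (L := Rpower c (- (1 / (beta - 1)))).
  assert (HL : 0 < L) by (unfold L, Rpower; apply exp_pos).
  assert (HLc : Rpower L (1 - beta) = c).
  { unfold L. rewrite Rpower_mult.
    replace (- (1 / (beta - 1)) * (1 - beta)) with 1 by (field; lra).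
    apply Rpower_1, Hc0. }
  assert (HGinv : forall t, 0 < t -> 0 < Ginv t /\ G g (Ginv t) = t).
  { intros t Ht. destruct (G_onto_large g t Hp Hc Hinf Ht) as [y [Hy <-]].
    rewrite Hinv by assumption. split; [assumption|reflexivity]. }
  assert (Hsmall : forall d, 0 < d ->
    exists M, 0 < M /\ forall t, M < t -> 0 < Ginv t < d).
  { intros d Hd. assert (A1 := Rmax_l 1 (G g d)). assert (A2 := Rmax_r 1 (G g d)).
    exists (Rmax 1 (G g d)). split; [lra|]. intros t Ht.
    destruct (HGinv t ltac:(lra)) as [Hy HG]. split; [assumption|].
    destruct (Rlt_le_dec (Ginv t) d) as [|[Hlt|Heq]]; [assumption| |].
    - assert (G g (Ginv t) < G g d) by (apply G_decreasing; auto). lra.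
    - assert (G g d = t) by (rewrite Heq; exact HG). lra. }
  assert (Hratio : forall k eps, 0 < k -> 0 < eps ->
    exists M, 0 < M /\ forall t, M < t ->
      0 < Ginv t /\
      Rabs (G g (k * Ginv t) - Rpower k (1 - beta) * t) < eps * t /\
      Rabs (G g (x t) - c * t) < eps * t).
  { intros k eps Hk Heps.
    destruct (proj1 (filterlim_at_right0 _ _) (HGl k Hk) eps Heps)
      as [d [Hd H1]].
    destruct (Hsmall d Hd) as [M1 [HM1 H2]].
    destruct (proj1 (is_lim_p_infty_iff _ _) Hlim eps Heps) as [M2 H3].
    assert (A1 := Rmax_l M1 M2). assert (A2 := Rmax_r M1 M2).
    exists (Rmax M1 M2). split; [lra|]. intros t Ht.
    specialize (H2 t ltac:(lra)). specialize (H1 (Ginv t) H2).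
    specialize (H3 t ltac:(lra)).
    destruct (HGinv t ltac:(lra)) as [Hy HG]. rewrite HG in H1.
    split; [assumption|].
    assert (Hscale : forall v l, Rabs (v / t - l) < eps ->
      Rabs (v - l * t) < eps * t).
    { intros v l Hv. replace (v - l * t) with ((v / t - l) * t) by (field; lra).
      rewrite Rabs_mult, (Rabs_pos_eq t) by lra.
      apply Rmult_lt_compat_r; lra. }
    split; apply Hscale; assumption. }
  assert (Habove : forall k, L < k ->
    exists M, 0 < M /\ forall t, M < t -> 0 < Ginv t /\ x t < k * Ginv t).
  { intros k Hk.
    assert (Hkc : Rpower k (1 - beta) < c).
    { rewrite <- HLc. apply Rpower_lt_base_neg; lra. }
    destruct (Hratio k ((c - Rpower k (1 - beta)) / 2)) as [M [HM H]]; [lra|lra|].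
    exists M. split; [assumption|]. intros t Ht.
    destruct (H t Ht) as [Hy [H1 H2]]. split; [assumption|].
    apply Rabs_def2 in H1. apply Rabs_def2 in H2.
    destruct (Rlt_le_dec (x t) (k * Ginv t)) as [|[Hlt|Heq]]; [assumption| |].
    - assert (G g (x t) < G g (k * Ginv t)); [|lra].
      apply G_decreasing; auto. split; [|assumption].
      apply Rmult_lt_0_compat; lra.
    - rewrite Heq in H1. lra. }
  assert (Hbelow : forall k, 0 < k < L ->
    exists M, 0 < M /\ forall t, M < t -> 0 < Ginv t /\ k * Ginv t < x t).
  { intros k Hk.
    assert (Hkc : c < Rpower k (1 - beta)).
    { rewrite <- HLc. apply Rpower_lt_base_neg; lra. }
    destruct (Hratio k ((Rpower k (1 - beta) - c) / 2)) as [M [HM H]]; [lra|lra|].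
    exists M. split; [assumption|]. intros t Ht.
    destruct (H t Ht) as [Hy [H1 H2]]. split; [assumption|].
    apply Rabs_def2 in H1. apply Rabs_def2 in H2.
    destruct (Rlt_le_dec (k * Ginv t) (x t)) as [|[Hlt|Heq]]; [assumption| |].
    - assert (G g (k * Ginv t) < G g (x t)); [|lra].
      apply G_decreasing; auto. split; [|assumption]. apply Hx; lra.
    - rewrite Heq in H2. lra. }
  apply is_lim_p_infty_iff. intros eps Heps.
  assert (B1 := Rmax_l (L - eps) (L / 2)). assert (B2 := Rmax_r (L - eps) (L / 2)).
  destruct (Habove (L + eps)) as [M1 [HM1 H1]]; [lra|].
  destruct (Hbelow (Rmax (L - eps) (L / 2))) as [M2 [HM2 H2]].
  { split; [lra|]. apply Rmax_lub_lt; lra. }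
  assert (A1 := Rmax_l M1 M2). assert (A2 := Rmax_r M1 M2).
  exists (Rmax M1 M2). intros t Ht.
  destruct (H1 t ltac:(lra)) as [Hy Hu]. destruct (H2 t ltac:(lra)) as [_ Hl].
  apply Rabs_def1; apply Rmult_lt_reg_r with (Ginv t); try assumption;
    replace ((x t / Ginv t - L) * Ginv t) with (x t - L * Ginv t)
      by (field; lra); nra.
Qed.

(** * Delayed growth and the theorem *)

Lemma is_derive_of_within (f : R -> R) (t l : R) :
  0 < t -> is_derive_within (fun s => 0 <= s) f t l -> is_derive f t l.
Proof.
  intros Ht H. apply is_derive_Reals. intros eps Heps.
  destruct (proj1 (filterlim_locally _ _) H (mkposreal eps Heps)) as [d Hd].
  assert (Hdp := cond_pos d).
  assert (Hm : 0 < Rmin d t) by (apply Rmin_glb_lt; lra).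
  exists (mkposreal _ Hm). intros h Hh0 Hh. simpl in Hh.
  assert (H1 := Rmin_l d t). assert (H2 := Rmin_r d t).
  assert (Hq : Rabs ((f (t + h) - f t) / (t + h - t) - l) < eps).
  { apply Rabs_def2 in Hh as Hh'. apply (Hd (t + h)); [|lra|lra].
    change (Rabs (t + h - t) < d). replace (t + h - t) with h by ring. lra. }
  replace (t + h - t) with h in Hq by ring. exact Hq.
Qed.

(** The dynamical heart of the argument, free of [g].  The slope of [z] never
    exceeds [c], and it is nearly [c] at every time [t] at which [z] has not been
    much below [z t], relatively, over the delay window.

    The slope bound gives [z s >= z t - c tau(t)] on that window, and the loss
    [c tau(t)] is small compared with [t]; to compare it with [z t], some linear
    lower bound [k0 t] on [z] is needed beforehand.  This comes from a barrier:
    at a first contact of [z] with [k0 t], all values in the window lie above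
    [k0 (1 - eps) t = (1 - eps) z t], so the slope is at least [c / 2 > k0], which
    is impossible. *)
Lemma delayed_slope_linear_growth (z z' tau : R -> R) (c : R) :
  0 < c ->
  is_lim (fun t => tau t / t) p_infty (Finite 0) ->
  is_lim z p_infty p_infty ->
  (forall t, 0 < t -> is_derive z t (z' t)) ->
  (forall t, 0 < t -> z' t <= c) ->
  (forall k, k < c -> exists eps N, 0 < eps < 1 /\
     forall t, N < t -> 0 < t ->
       (forall s, t - tau t <= s <= t -> (1 - eps) * z t <= z s) ->
       k <= z' t) ->
  is_lim (fun t => z t / t) p_infty (Finite c).
Proof.
  intros Hc Htau Hz Hd Hup Hlow.
  assert (Hdelay : forall eps, 0 < eps ->
    exists M, 0 < M /\ forall t, M < t -> tau t <= eps * t).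
  { intros eps Heps.
    destruct (proj1 (is_lim_p_infty_iff _ _) Htau eps Heps) as [M HM].
    exists (Rmax M 1).
    assert (H1 := Rmax_l M 1). assert (H2 := Rmax_r M 1).
    split; [lra|]. intros t Ht. specialize (HM t ltac:(lra)).
    apply Rabs_def2 in HM.
    replace (tau t) with (tau t / t * t) by (field; lra).
    apply Rmult_le_compat_r; lra. }
  assert (Hgrow : forall s t, 0 < s -> s <= t -> z t - z s <= c * (t - s)).
  { intros s t Hs Hst. apply derive_le_growth with z'; [assumption| |];
      intros r Hr; [apply Hd|apply Hup]; lra. }
  assert (Hcrude : exists k0 T, 0 < k0 /\ 0 < T /\
    forall t, T <= t -> k0 * t < z t).
  { destruct (Hlow (c / 2)) as [eps [N [Heps Hslope]]]; [lra|].
    destruct (Hdelay eps ltac:(lra)) as [T1 [HT1 Hdel]].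
    destruct (proj1 (is_lim_p_infty_p_infty_iff _) Hz 1) as [T0 HT0].
    (* For [t >= T] the window starts after [(1 - eps) T], where already
       [z > 1]. *)
    set (T := Rmax (Rmax T1 N) (Rmax T0 0 / (1 - eps)) + 1).
    assert (HT : T1 < T /\ N < T /\ 0 < T /\ T0 < (1 - eps) * T).
    { assert (A1 := Rmax_l (Rmax T1 N) (Rmax T0 0 / (1 - eps))).
      assert (A2 := Rmax_r (Rmax T1 N) (Rmax T0 0 / (1 - eps))).
      assert (A3 := Rmax_l T1 N). assert (A4 := Rmax_r T1 N).
      assert (A5 := Rmax_l T0 0).
      repeat split; try (unfold T; lra).
      apply Rle_lt_trans with (1 := A5).
      apply Rmult_lt_reg_r with (/ (1 - eps)); [apply Rinv_0_lt_compat; lra|].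
      replace ((1 - eps) * T * / (1 - eps)) with T by (field; lra).
      unfold Rdiv in A2. unfold T. lra. }
    (* [c / 4] keeps the slope of the barrier below [c / 2], and [/ (2 * T)]
       keeps the barrier below [1] up to time [T]. *)
    set (k0 := Rmin (c / 4) (/ (2 * T))).
    assert (HiT : 0 < / (2 * T)) by (apply Rinv_0_lt_compat; lra).
    assert (Hk0 : 0 < k0 /\ k0 <= c / 4 /\ k0 <= / (2 * T)).
    { unfold k0. repeat split; [|apply Rmin_l|apply Rmin_r].
      apply Rmin_glb_lt; lra. }
    assert (Hk0T : k0 * T < 1).
    { apply Rle_lt_trans with (/ (2 * T) * T).
      - apply Rmult_le_compat_r; lra.
      - replace (/ (2 * T) * T) with (1 / 2) by (field; lra). lra. }
    assert (Hinit : forall s, (1 - eps) * T <= s <= T -> k0 * s < z s).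
    { intros s Hs. assert (1 < z s) by (apply HT0; lra). nra. }
    exists k0, T. split; [lra|]. split; [lra|].
    assert (Hpos : forall t, T <= t -> 0 < z t - k0 * t).
    { apply positive_of_positive_slope_at_zeros with (fun t => z' t - k0).
      - intros t Ht. apply (is_derive_minus (V := R_NormedModule)).
        + apply Hd; lra.
        + auto_derive; [exact I|ring].
      - specialize (Hinit T). nra.
      - intros t Ht Hzt Hbefore.
        assert (c / 2 <= z' t); [|lra].
        apply Hslope; [lra|lra|]. intros s Hs.
        specialize (Hdel t ltac:(lra)).
        assert (Hs1 : (1 - eps) * t <= s) by lra.
        assert (Hs2 : (1 - eps) * T <= s) by nra.
        assert (Hks : k0 * s <= z s).
        { destruct (Rle_lt_dec s T) as [HsT|HsT]; [left; apply Hinit; lra|].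
          destruct (Rlt_le_dec s t) as [Hst|Hst].
          - specialize (Hbefore s). lra.
          - replace s with t by lra. lra. }
        replace (z t) with (k0 * t) by lra. nra. }
    intros t Ht. specialize (Hpos t Ht). lra. }
  destruct Hcrude as [k0 [T [Hk0 [HT Hcrude]]]].
  assert (Hslope : forall k, k < c -> exists M, 0 < M /\
    forall t, M <= t -> k <= z' t).
  { intros k Hk. destruct (Hlow k Hk) as [eps [N [Heps Hs]]].
    (* With [tau t <= d * t], the loss [c * tau t] is at most
       [eps * k0 * t <= eps * z t]; the bound [1 / 2] keeps the window in the
       positive times. *)
    set (d := Rmin (1 / 2) (eps * k0 / c)).
    assert (Hek : 0 < eps * k0 / c).
    { apply Rdiv_lt_0_compat; [|assumption]. apply Rmult_lt_0_compat; lra. }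
    assert (Hd' : 0 < d /\ d <= 1 / 2 /\ c * d <= eps * k0).
    { unfold d. repeat split; [apply Rmin_glb_lt; lra|apply Rmin_l|].
      apply Rle_trans with (c * (eps * k0 / c)); [|right; field; lra].
      apply Rmult_le_compat_l; [lra|]. apply Rmin_r. }
    destruct (Hdelay d ltac:(lra)) as [M [HM Hdel]].
    assert (A1 := Rmax_l (Rmax M N) T). assert (A2 := Rmax_r (Rmax M N) T).
    assert (A3 := Rmax_l M N). assert (A4 := Rmax_r M N).
    exists (Rmax (Rmax M N) T + 1). split; [lra|].
    intros t Ht. apply Hs; [lra|lra|]. intros s Hst.
    specialize (Hdel t ltac:(lra)). specialize (Hcrude t ltac:(lra)).
    specialize (Hgrow s t ltac:(nra) ltac:(lra)).
    assert (c * (t - s) <= eps * k0 * t) by nra. nra. }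
  apply is_lim_p_infty_iff. intros eps Heps.
  destruct (Hslope (c - eps / 2)) as [M [HM HsM]]; [lra|].
  set (K := Rabs (z M) + Rabs ((c - eps / 2) * M) + c * M).
  assert (P1 := Rabs_pos (z M)). assert (P2 := Rabs_pos ((c - eps / 2) * M)).
  assert (HcM : 0 < c * M) by (apply Rmult_lt_0_compat; lra).
  assert (A1 := Rmax_l M (2 * K / eps)). assert (A2 := Rmax_r M (2 * K / eps)).
  exists (Rmax M (2 * K / eps)). intros t Ht.
  assert (Hgt := Hgrow M t HM ltac:(lra)).
  assert (Hlt : (c - eps / 2) * (t - M) <= z t - z M).
  { apply derive_ge_growth with z'; [lra| |]; intros r Hr;
      [apply Hd; lra|apply HsM; lra]. }
  assert (HK : K < eps / 2 * t).
  { replace K with (eps / 2 * (2 * K / eps)) by (field; lra).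
    apply Rmult_lt_compat_l; lra. }
  assert (B1 := Rle_abs (z M)). assert (B2 := Rle_abs (- z M)).
  rewrite Rabs_Ropp in B2. assert (B3 := Rle_abs ((c - eps / 2) * M)).
  unfold K in HK.
  apply Rabs_def1; apply Rmult_lt_reg_r with t; try lra;
    replace ((z t / t - c) * t) with (z t - c * t) by (field; lra); nra.
Qed.

Theorem theorem21
  (tau : R -> R) (taubar : R) (a b : R) (g : R -> R) (beta : R)
  (psi x : R -> R)
  (tau_nonneg : forall t, 0 <= t -> 0 <= tau t)
  (tau_cont : continuous_on (fun t => 0 <= t) tau)
  (tau_lim : is_lim (fun t => t - tau t) p_infty p_infty)
  (taubar_inf :
     is_glb_Rbar (fun y => exists t, 0 <= t /\ y = t - tau t)
                 (Finite (- taubar)))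
  (tau_sublinear : is_lim (fun t => tau t / t) p_infty (Finite 0))
  (b_pos : 0 < b) (b_lt_a : b < a)
  (g_nonneg : forall u, 0 <= u -> 0 <= g u)
  (g_cont : continuous_on (fun u => 0 <= u) g)
  (g_zero : g 0 = 0)
  (g_pos : forall u, 0 < u -> 0 < g u)
  (g_incr : exists delta1, 0 < delta1 /\
     forall u v, 0 < u -> u <= v -> v < delta1 -> g u <= g v)
  (beta_gt1 : 1 < beta)
  (g_RV : RV0 beta g)
  (psi_cont : continuous_on (fun t => - taubar <= t <= 0) psi)
  (psi_pos : forall t, - taubar <= t <= 0 -> 0 < psi t)
  (x_sol : is_solution a b taubar tau g psi x)
  (x_lim : is_lim x p_infty (Finite 0)) :
  is_lim (fun t => G g (x t) / t) p_infty (Finite (a - b)) /\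
  (forall Ginv : R -> R, is_G_inverse g Ginv ->
     is_lim (fun t => x t / Ginv t) p_infty
            (Finite (Rpower (a - b) (- (1 / (beta - 1)))))).
Proof.
  destruct x_sol as [_ [Hxpos [_ Heq]]].
  assert (Hgc : forall u, 0 < u -> continuous g u).
  { intros u Hu. apply (continuous_on_interior _ g u g_cont); [lra|].
    generalize (locally_gt 0 u Hu). apply filter_imp. intros v Hv. lra. }
  assert (Hbar : forall t, 0 <= t -> - taubar <= t - tau t).
  { intros t Ht. apply (proj1 taubar_inf (t - tau t)).
    exists t. split; [assumption|reflexivity]. }
  assert (Hx : forall t, 0 < t -> 0 < x t).
  { intros t Ht. apply Hxpos.
    specialize (Hbar t). specialize (tau_nonneg t). lra. }
  assert (Hinf := G_unbounded_at_right0 g beta g_pos Hgc beta_gt1 g_RV).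
  set (z := fun t => G g (x t)).
  (* [s] is a point of the delay window at which the maximum is attained. *)
  assert (Hslope : forall t, 0 < t -> exists s, t - tau t <= s <= t /\
    is_derive z t (a - b * (g (x s) / g (x t))) /\ g (x t) <= g (x s)).
  { intros t Ht. destruct (Heq t) as [m [[Hm [s [Hs Hsm]]] Hder]]; [lra|].
    assert (Hgx := g_pos (x t) (Hx t Ht)).
    exists s. split; [assumption|]. rewrite Hsm. split.
    - replace (a - b * (m / g (x t)))
        with (scal (- a * g (x t) + b * m) (- / g (x t))).
      + apply (is_derive_comp (V := R_NormedModule) (G g) x).
        * apply is_derive_G; auto.
        * apply is_derive_of_within; assumption.
      + change ((- a * g (x t) + b * m) * - / g (x t) = a - b * (m / g (x t))).
        field. lra.
    - apply Hm. specialize (tau_nonneg t). lra. }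
  assert (Hlim : is_lim (fun t => z t / t) p_infty (Finite (a - b))).
  { apply delayed_slope_linear_growth with (z' := Derive z) (tau := tau);
      [lra|assumption| | | |].
    - apply is_lim_p_infty_p_infty_iff. intros K.
      destruct (Hinf K) as [e [He HK]].
      destruct (proj1 (is_lim_p_infty_iff _ _) x_lim e He) as [M HM].
      assert (A1 := Rmax_l M 0). assert (A2 := Rmax_r M 0).
      exists (Rmax M 0). intros t Ht. apply HK.
      specialize (HM t ltac:(lra)). apply Rabs_def2 in HM.
      specialize (Hx t). lra.
    - intros t Ht. apply Derive_correct.
      destruct (Hslope t Ht) as [s [_ [Hd _]]]. eexists. exact Hd.
    - intros t Ht. destruct (Hslope t Ht) as [s [_ [Hd Hge]]].
      rewrite (is_derive_unique _ _ _ Hd).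
      assert (Hgx := g_pos (x t) (Hx t Ht)).
      assert (1 <= g (x s) / g (x t)); [|nra].
      apply Rmult_le_reg_r with (g (x t)); [assumption|].
      replace (g (x s) / g (x t) * g (x t)) with (g (x s)) by (field; lra).
      lra.
    - intros k Hk.
      (* A ratio [g (x s) / g (x t)] of at most [1 + (a - b - k) / b] gives a
         slope of at least [a - b - (a - b - k) = k]. *)
      destruct (g_ratio_of_G_ratio g beta ((a - b - k) / b) g_pos Hgc g_incr
        beta_gt1 g_RV) as [eps [d [Heps [Hd Hreg]]]];
        [apply Rdiv_lt_0_compat; lra|].
      destruct (proj1 (is_lim_p_infty_iff _ _) x_lim d Hd) as [M HM].
      exists eps, M. split; [assumption|]. intros t HMt Ht Hdelay.
      destruct (Hslope t Ht) as [s [Hs [Hder _]]].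
      rewrite (is_derive_unique _ _ _ Hder).
      specialize (HM t HMt). apply Rabs_def2 in HM.
      assert (Hxt := Hx t Ht). assert (Hgx := g_pos (x t) Hxt).
      assert (Hxs : 0 < x s) by (apply Hxpos; specialize (Hbar t); lra).
      specialize (Hreg (x t) (x s) ltac:(lra) Hxs (Hdelay s Hs)).
      assert (Hr : b * (g (x s) / g (x t)) <= b * (1 + (a - b - k) / b)).
      { apply Rmult_le_compat_l; [lra|].
        apply Rmult_le_reg_r with (g (x t)); [assumption|].
        replace (g (x s) / g (x t) * g (x t)) with (g (x s)) by (field; lra).
        assumption. }
      replace (b * (1 + (a - b - k) / b)) with (a - k) in Hr by (field; lra).
      lra. }
  split; [exact Hlim|]. intros Ginv Hinv.
  apply G_asymptotic_inverse with g; auto. lra.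
Qed.
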